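(* Let $k\ge 4$ and let $H_k$ be the thin headless spider on $2k$ vertices. Then $\gamma^{\rm L}(H_k)=\gamma^{\rm O}(H_k)=k-1$, $\gamma^{\rm I}(H_k)=k+1$, and $\gamma^{\rm F}(H_k)=2k-2$.
   Context: The thin headless spider $H_k$ has vertex set $Q\cup S$ with $Q=\{q_1,\dots,q_k\}$, $S=\{s_1,\dots,s_k\}$, where $Q$ induces a clique, $S$ induces a stable set, and $q_i$ is adjacent to $s_j$ iff $i=j$. For a graph $G=(V,E)$, $N(v)$ denotes the open and $N[v]=N(v)\cup\{v\}$ the closed neighborhood of $v$. A set $C\subseteq V$ is: a locating set (L-set) if the sets $N(v)\cap C$, $v\in V\setminus C$, are pairwise distinct; an open-separating set (O-set) if the sets $N(v)\cap C$, $v\in V$, are pairwise distinct; a closed-separating set (I-set) if the sets $N[v]\cap C$, $v\in V$, are pairwise distinct; a full-separating set (F-set) if it is both an O-set and an I-set. $\gamma^{\rm S}(G)$ is the minimum cardinality of an S-set of $G$. *)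

(* Defs.v *)
From mathcomp Require Import all_boot.

Set Implicit Arguments.
Unset Strict Implicit.
Unset Printing Implicit Defensive.

Record sgraph := SGraph {
  vertex :> finType;
  adj : rel vertex;
  adj_sym : symmetric adj;
  adj_irr : irreflexive adj
}.

Definition open_nbh (G : sgraph) (v : G) : {set G} := [set u | adj v u].
Definition closed_nbh (G : sgraph) (v : G) : {set G} := v |: open_nbh v.

Definition L_set (G : sgraph) (C : {set G}) : Prop :=
  {in ~: C &, injective (fun v => open_nbh v :&: C)}.

Definition O_set (G : sgraph) (C : {set G}) : Prop :=
  injective (fun v : G => open_nbh v :&: C).

Definition I_set (G : sgraph) (C : {set G}) : Prop :=
  injective (fun v : G => closed_nbh v :&: C).

Definition F_set (G : sgraph) (C : {set G}) : Prop := O_set C /\ I_set C.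

(* [is_gamma S n] reads "gamma^S(G) = n". It is a relation rather than a
   function because a graph may have no S-set at all (an O-set excludes open
   twins, an I-set closed twins); existence is part of the assertion. *)
Definition is_gamma (G : sgraph) (S : {set G} -> Prop) (n : nat) : Prop :=
  (exists2 C : {set G}, S C & #|C| = n) /\
  (forall C : {set G}, S C -> n <= #|C|).

(* [inl i] is the clique vertex q_i and [inr i] the stable vertex s_i. *)
Definition spider_adj (k : nat) : rel ('I_k + 'I_k)%type :=
  fun x y =>
    match x, y with
    | inl i, inl j => i != j
    | inr _, inr _ => false
    | inl i, inr j | inr j, inl i => i == j
    end.

Lemma spider_adj_sym k : symmetric (@spider_adj k).
Proof. by move=> [i|i] [j|j] //=; rewrite eq_sym. Qed.

Lemma spider_adj_irr k : irreflexive (@spider_adj k).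
Proof. by move=> [i|i] //=; rewrite eqxx. Qed.

Definition thin_spider (k : nat) : sgraph :=
  SGraph (@spider_adj_sym k) (@spider_adj_irr k).

(* Main.v *)
Require Import Defs.
From mathcomp Require Import all_boot.

(** Write a vertex set as A on the clique side and B on the stable side.  The
    open traces of s_i are A restricted to {i}, so an O-set has at most one
    index outside A, and for k >= 4 this suffices.  The closed traces of q_i are
    A together with B restricted to {i}, so an I-set has at most one index
    outside B; telling q_i from s_i then amounts to |A| >= 2.  Finally two
    indices outside both A and B give stable vertices with empty open trace,
    which bounds L-sets from below. *)

Set Implicit Arguments.
Unset Strict Implicit.
Unset Printing Implicit Defensive.

(** The bridge between counting and separation: a pair of vertices with distinct indices [i], [j] is
    told apart exactly when one of the two indices is present. *)
Lemma setC_card_le1P (T : finType) (A : {set T}) :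
  reflect (forall i j, i != j -> (i \in A) || (j \in A)) (#|~: A| <= 1).
Proof.
apply: (iffP card_le1_eqP) => [H i j | H i j].
  apply: contraR; rewrite negb_or -!in_setC => /andP[iA jA].
  by apply/eqP/H.
rewrite !in_setC => /negbTE iA /negbTE jA; apply/eqP/idPn => /H.
by rewrite iA jA.
Qed.

Lemma O_set_L_set (G : sgraph) (C : {set G}) : O_set C -> L_set C.
Proof. by move=> OC x y _ _ /OC. Qed.

Section ThinSpider.

Variable k : nat.
Implicit Types (A B : {set 'I_k}) (C : {set thin_spider k}).

Definition spider_set A B : {set thin_spider k} :=
  [set x : 'I_k + 'I_k | match x with inl i => i \in A | inr i => i \in B end].

Lemma spider_setE C :
  exists A, exists B, C = spider_set A B.
Proof.
exists [set i | (inl i : thin_spider k) \in C].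
exists [set i | (inr i : thin_spider k) \in C].
by apply/setP => -[] i; rewrite !inE.
Qed.

Lemma card_spider_set A B : #|spider_set A B| = #|A| + #|B|.
Proof.
have -> : spider_set A B = (inl @: A) :|: (inr @: B).
  apply/setP => -[] i; rewrite !inE.
    rewrite mem_imset; last exact: inl_inj.
    by case: imsetP => [[]//|_]; rewrite orbF.
  rewrite orbC mem_imset; last exact: inr_inj.
  by case: imsetP => [[]//|_]; rewrite orbF.
rewrite cardsU (_ : _ :&: _ = set0) ?cards0 ?subn0.
  by rewrite !card_imset //; [exact: inr_inj | exact: inl_inj].
by apply/setP => x; rewrite !inE; apply/andP => -[/imsetP[a _ ->] /imsetP[]].
Qed.

Lemma L_set_spider_set A B : L_set (spider_set A B) -> #|~: (A :|: B)| <= 1.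
Proof.
move=> LC; apply/setC_card_le1P => i j; apply: contraR.
rewrite !inE !negb_or => /andP[/andP[/negbTE iA iB] /andP[/negbTE jA jB]].
apply/eqP; suff [] : (inr i : thin_spider k) = inr j by [].
apply: LC; rewrite ?inE //; apply/setP => -[] a; rewrite !inE //=.
by case: eqVneq => [->|_]; case: eqVneq => [->|_]; rewrite ?iA ?jA.
Qed.

(** [q_i] and [q_j] disagree among clique vertices only at [q_i] and [q_j], so pairs on one side
    need just the pairwise condition on [A]. [B] stays arbitrary: it is empty in the O-witness and
    large in the F-witness. *)
Lemma O_set_spider_set A B :
  4 <= k -> O_set (spider_set A B) <-> #|~: A| <= 1.
Proof.
move=> k4; split=> [OC | A1].
  apply/setC_card_le1P => i j; apply: contraR.
  rewrite negb_or => /andP[/negbTE iA /negbTE jA].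
  apply/eqP; suff [] : (inr i : thin_spider k) = inr j by [].
  apply: OC; apply/setP => -[] a; rewrite !inE //=.
  by case: eqVneq => [->|_]; case: eqVneq => [->|_]; rewrite ?iA ?jA.
have qs i j : open_nbh (inl i : thin_spider k) :&: spider_set A B <>
              open_nbh (inr j : thin_spider k) :&: spider_set A B.
  (* From [4 <= k], [A] has at least 3 elements, hence one outside [i], [j]; then [q_a] is adjacent
     to [q_i] but not to [s_j]. *)
  have [a] : exists a, a \in A :\: [set i; j].
    apply/set0Pn; rewrite -card_gt0 cardsD subn_gt0.
    apply: leq_ltn_trans (subset_leq_card (subsetIr _ _)) _.
    apply: (@leq_ltn_trans 2); first by rewrite cards2; case: eqP.
    have := cardsC A; rewrite card_ord => E.
    by rewrite -(leq_add2r #|~: A|) E (leq_trans _ k4) // addnC; case: #|~: A| A1 => [|[]].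
  rewrite !inE negb_or => /andP[/andP[ai aj] aA] /setP/(_ (inl a)).
  by rewrite !inE /= aA !andbT [i == a]eq_sym ai (negbTE aj).
move/setC_card_le1P: A1 => A1.
move=> [] i [] j => [E | /qs[] | /esym/qs[] | E].
- congr inl; apply/eqP/idPn => ij; move/setP: E => E.
  have := E (inl j); have := E (inl i); rewrite !inE /= !eqxx /= ij eq_sym ij /=.
  by have /orP[] := A1 _ _ ij => ->.
- congr inr; apply/eqP/idPn => ij; move/setP: E => E.
  have := E (inl j); have := E (inl i).
  rewrite !inE /= !eqxx /= (negbTE ij) eq_sym (negbTE ij) /=.
  by have /orP[] := A1 _ _ ij => ->.
Qed.

Lemma I_set_spider_set A B :
  0 < k -> I_set (spider_set A B) <-> 1 < #|A| /\ #|~: B| <= 1.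
Proof.
move=> k0; split=> [IC | [A2 B1]].
  split; last first.
    apply/setC_card_le1P => i j; apply: contraR.
    rewrite negb_or => /andP[/negbTE iB /negbTE jB].
    apply/eqP; suff [] : (inl i : thin_spider k) = inl j by [].
    apply: IC; apply/setP => -[] a; rewrite !inE //=.
      (* Equality of vertices on the same side computes to equality of indices. *)
      rewrite -[_ == _ :> thin_spider k]/(a == i).
      rewrite -[_ == inl j :> thin_spider k]/(a == j).
      by rewrite ![a == _]eq_sym !orbN.
    by case: eqVneq => [<-|_]; case: eqVneq => [<-|_]; rewrite ?iB ?jB.
  rewrite ltnNge; apply/negP => A1.
  (* If [A] lies within [{j}], then [q_j] and [s_j] both have closed trace [A] on the clique side
     and [B] restricted to [{j}] on the stable side. For empty [A] any index will do. *)
  have [j Aj] : exists j, A \subset [set j].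
    have [A0|[j jA]] := set_0Vmem A.
      by exists (Ordinal k0); rewrite A0 sub0set.
    by exists j; apply/subsetP => a aA; rewrite inE (card_le1_eqP A1 _ _ aA jA).
  suff : (inl j : thin_spider k) = inr j by [].
  apply: IC; apply/setP => -[] a; rewrite !inE /=.
    rewrite -[_ == _ :> thin_spider k]/(a == j).
    case: (boolP (a \in A)) => [/(subsetP Aj)|_]; last by rewrite !andbF.
    by rewrite inE => /eqP->; rewrite eqxx.
  rewrite -[_ == inr j :> thin_spider k]/(a == j).
  by rewrite orbF eq_sym.
have qs i j : closed_nbh (inl i : thin_spider k) :&: spider_set A B <>
              closed_nbh (inr j : thin_spider k) :&: spider_set A B.
  (* Only [j] has to be avoided: closed neighborhoods allow [a = i], so two elements of [A]
     suffice. *)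
  have [a] : exists a, a \in A :\ j.
    apply/set0Pn; rewrite -card_gt0 -(ltn_add2l (j \in A)) -cardsD1 addn0.
    by apply: leq_ltn_trans A2; case: (_ \in _).
  rewrite !inE => /andP[aj aA] /setP/(_ (inl a)).
  rewrite !inE /= aA !andbT.
  rewrite -[_ == inl i :> thin_spider k]/(a == i).
  by rewrite [i == a]eq_sym orbN (negbTE aj).
move/setC_card_le1P: B1 => B1.
move=> [] i [] j => [E | /qs[] | /esym/qs[] | E].
- congr inl; apply/eqP/idPn => ij; move/setP: E => E.
  have := E (inr j); have := E (inr i).
  rewrite !inE /= !eqxx /= (negbTE ij) eq_sym (negbTE ij) /=.
  by have /orP[] := B1 _ _ ij => ->.
(* A stable vertex lies in its own closed neighborhood, so the condition on [B] separates stable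
   pairs too. *)
- congr inr; apply/eqP/idPn => ij; move/setP: E => E.
  have := E (inr j); have := E (inr i).
  rewrite !inE /= !eqxx /= !orbF.
  rewrite -[_ == inr j :> thin_spider k]/(i == j).
  rewrite -[_ == inr i :> thin_spider k]/(j == i).
  rewrite (negbTE ij) eq_sym (negbTE ij) /=.
  by have /orP[] := B1 _ _ ij => ->.
Qed.

Lemma setC_card_le1_geq A : #|~: A| <= 1 -> k - 1 <= #|A|.
Proof.
by move=> A1; rewrite leq_subLR -[k in k <= _]card_ord -(cardsC A) addnC leq_add2r.
Qed.

End ThinSpider.

Theorem theorem6 (k : nat) (hk : 4 <= k) :
  [/\ is_gamma (@L_set (thin_spider k)) (k - 1),
      is_gamma (@O_set (thin_spider k)) (k - 1),
      is_gamma (@I_set (thin_spider k)) (k + 1)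
    & is_gamma (@F_set (thin_spider k)) (2 * k - 2)].
Proof.
have k1 : 1 < k by apply: leq_trans hk.
have k0 : 0 < k by apply: ltnW.
pose z : 'I_k := Ordinal k0; pose o : 'I_k := Ordinal k1.
(* Omitting one index is the most that the O- and I-criteria tolerate. *)
pose D := [set~ z].
have D1 : #|~: D| <= 1 by rewrite setCK cards1.
have cD : #|D| = k - 1 by rewrite cardsC1 card_ord subn1.
have OD B : O_set (spider_set D B) by apply/O_set_spider_set.
split; split.
- by exists (spider_set D set0); rewrite ?card_spider_set ?cards0 ?addn0 //; exact: O_set_L_set.
- move=> C; have [A [B ->]] := spider_setE C.
  move=> /L_set_spider_set/setC_card_le1_geq H; rewrite card_spider_set.
  by apply: leq_trans H _; rewrite cardsU leq_subr.
- by exists (spider_set D set0); rewrite ?card_spider_set ?cards0 ?addn0.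
- move=> C; have [A [B ->]] := spider_setE C.
  move=> /(O_set_spider_set _ _ hk)/setC_card_le1_geq H; rewrite card_spider_set.
  exact: leq_trans H (leq_addr _ _).
(* Both conditions of the I-criterion are met tightly: 2 + (k - 1) = k + 1. *)
- exists (spider_set [set z; o] D).
    by apply/I_set_spider_set => //; rewrite cards2.
  by rewrite card_spider_set cards2 cD /= addnC addnBAC // -addnBA.
- move=> C; have [A [B ->]] := spider_setE C.
  move=> /(I_set_spider_set _ _ k0)[A2 /setC_card_le1_geq H].
  rewrite card_spider_set (leq_trans _ (leq_add A2 H)) //.
  by rewrite [2 + _]addnC -[2]/(1 + 1) addnA subnK.
- exists (spider_set D D).
    split; first exact: OD.
    by apply/I_set_spider_set => //; rewrite cD ltn_subRL (leq_trans _ hk).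
  by rewrite card_spider_set cD addnn -mul2n mulnBr.
(* The O-condition bounds [A] and the I-condition bounds [B]; the sides are disjoint, so the bounds
   add. *)
- move=> C; have [A [B ->]] := spider_setE C.
  case=> /(O_set_spider_set _ _ hk)/setC_card_le1_geq HA.
  move=> /(I_set_spider_set _ _ k0)[_ /setC_card_le1_geq HB].
  rewrite card_spider_set (leq_trans _ (leq_add HA HB)) //.
  by rewrite addnn -mul2n mulnBr.
Qed.
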